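(* Let $k$ be a positive integer, $n\ge k+2$, let $\mathcal F$ be a union-closed family over the universe $[k]$, and let $\mathcal H=\mathcal F\cup\{[n]\}$ (a union-closed family over $[n]$). For $A\subseteq[n]$ write $A_1=A\cap[k]$ and $A_2=A\cap([n]\setminus[k])$. Let $A\in 2^{[n]}$ and let $t$ be an integer with $1\le t\le k$. If $A$ satisfies any of the conditions (i) $A_2=\emptyset$ and $A_1\in\overline{\mathcal F}^{(t)}$; (iii) $A_2=[n]\setminus[k]$ and for every $E\in\overline{\mathcal F}^{(t-1)}$ with $E\not\subseteq A$ we have $E\cup A\in\overline{\mathcal H}^{(t-1)}$; (v) $|A_1|\ge k-t+1$; then $A\in\overline{\mathcal H}^{(t)}$. If $A$ satisfies any of the conditions (ii) $A_2=\emptyset$ and $A_1\notin\overline{\mathcal F}^{(t)}$; (iv) $A_2=[n]\setminus[k]$ and there exists $E\in\overline{\mathcal F}^{(t-1)}$ with $E\not\subseteq A$ and $E\cup A\notin\overline{\mathcal H}^{(t-1)}$; (vi) $A_2\neq\emptyset$, $A_2\ne[n]\setminus[k]$ and $|A_1|\le k-t$; then $A\notin\overline{\mathcal H}^{(t)}$.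
   Context: A family $\mathcal F$ of subsets of a universe $[m]=\{1,\dots,m\}$ is union-closed over $[m]$ if $[m]\in\mathcal F$ and $A\cup B\in\mathcal F$ for all $A,B\in\mathcal F$. Convention: the empty set is never a member of any family considered; $2^{[m]}$ denotes the family of all nonempty subsets of $[m]$. The closure of a union-closed family $\mathcal F$ over $[m]$ is $\overline{\mathcal F}=\{A\in 2^{[m]}:\ \mathcal F\cup\{A\}\text{ is union-closed}\}$; iterated closures are $\overline{\mathcal F}^{(0)}=\mathcal F$, $\overline{\mathcal F}^{(i)}=\overline{\overline{\mathcal F}^{(i-1)}}$. Here closures of $\mathcal F$ are taken over the universe $[k]$ and closures of $\mathcal H$ over the universe $[n]$. *)

(* Defs.v *)
From mathcomp Require Import all_boot.

Set Implicit Arguments.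
Unset Strict Implicit.
Unset Printing Implicit Defensive.

(* Universes are subsets U of an ambient finite type T, so that families over  *)
(* nested universes such as [k] and [n] are directly comparable.               *)

Section UnionClosed.

Variables (T : finType) (U : {set T}).
Implicit Types (A B : {set T}) (F : {set {set T}}).

(* 2^U, without the empty set *)
Definition nonempty_subsets : {set {set T}} := powerset U :\ set0.

Definition union_closed F : bool :=
  [&& F \subset nonempty_subsets, U \in F
    & [forall A in F, forall B in F, A :|: B \in F]].

Definition uc_closure F : {set {set T}} :=
  [set A in nonempty_subsets | union_closed (A |: F)].

Definition iter_closure (i : nat) F : {set {set T}} := iter i uc_closure F.

End UnionClosed.

(* [k] = {1, ..., k} inside [n], the elements being numbered from 0 in 'I_n *)
Definition segment (n k : nat) : {set 'I_n} := [set i : 'I_n | i < k].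

Lemma union_closed_extend (n k : nat) (F : {set {set 'I_n}}) :
  0 < n -> union_closed (segment n k) F ->
  union_closed [set: 'I_n] (F :|: [set [set: 'I_n]]).
Proof.
rewrite setUC; move=> n0 /and3P[sF UF /forall_inP cF]; apply/and3P; split.
- apply/subsetP=> A /setU1P[->|AF].
    by rewrite !inE subsetT andbT -card_gt0 cardsT card_ord.
  by move/subsetP: sF => /(_ _ AF); rewrite !inE subsetT => /andP[->].
- exact: setU11.
apply/forall_inP=> A /setU1P[->|AF]; apply/forall_inP=> B.
  by rewrite setTU setU11.
case/setU1P=> [->|BF]; first by rewrite setUT setU11.
by rewrite setU1r //; apply: (forall_inP (cF A AF)).
Qed.

(* Main.v *)
Require Import Defs.
From mathcomp Require Import all_boot.
From mathcomp Require Import zify.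

(** Call A low if A is contained in K, full if A contains the complement of K,
    and mixed otherwise.  The i-th closures of F (over K) and of H = F + {N}
    (over N) are compared by one induction on i, carrying four facts: the low
    members of H_i are exactly the members of F_i; a mixed set A lies in H_i
    exactly when |A :&: K| > |K| - i; the full members of H_i form an up-set;
    and H_i contains every full A with |A :&: K| >= |K| - i.  The up-set property
    is what reduces membership of a full set in H_(i+1) to unions with F_i. *)

Set Implicit Arguments.
Unset Strict Implicit.
Unset Printing Implicit Defensive.

(** * Closures of union-closed families over a fixed universe *)

Section Closure.

Variables (T : finType) (U : {set T}).
Implicit Types (A B C : {set T}) (F : {set {set T}}).

Lemma in_nonempty_subsets A :
  (A \in nonempty_subsets U) = (A != set0) && (A \subset U).
Proof. by rewrite !inE. Qed.

Lemma union_closedP F :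
  reflect [/\ {in F, forall A, A \in nonempty_subsets U}, U \in F
            & {in F &, forall A B, A :|: B \in F}]
          (union_closed U F).
Proof.
apply: (iffP and3P) => [[/subsetP sF UF /forall_inP cF]|[sF UF cF]]; split=> //.
- by move=> A B AF BF; apply: (forall_inP (cF A AF)).
- exact/subsetP.
- by apply/forall_inP=> A AF; apply/forall_inP=> B; apply: cF.
Qed.

Lemma uc_closureP F A : union_closed U F ->
  reflect (A \in nonempty_subsets U /\ {in F, forall B, A :|: B \in A |: F})
          (A \in uc_closure U F).
Proof.
case/union_closedP=> sF UF cF; rewrite [A \in uc_closure _ _]in_set.
apply: (iffP andP) => -[sA cA]; split=> //.
  move=> B BF; case/union_closedP: cA => _ _; apply; first exact: setU11.
  exact: setU1r.
apply/union_closedP; split; first by move=> B /setU1P[->|/sF].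
  exact: setU1r.
move=> B C /setU1P[->|BF] /setU1P[->|CF].
- by rewrite setUid setU11.
- exact: cA.
- by rewrite setUC cA.
- by rewrite setU1r ?cF.
Qed.

(** For [C] in [F], first absorb [C] into [B], then the result into [A]. The only delicate case is
    [A :|: (B :|: C) = A]: it forces [B \subset A], hence [A :|: B = A]. *)
Lemma union_closed_closure F : union_closed U F -> union_closed U (uc_closure U F).
Proof.
move=> ucF; have /union_closedP[sF UF cF] := ucF.
apply/union_closedP; split.
- by move=> A /(uc_closureP _ ucF)[].
- apply/(uc_closureP _ ucF); split; first exact: sF.
  move=> B /sF; rewrite in_nonempty_subsets => /andP[_ BU].
  by rewrite (setUidPl BU) setU11.
move=> A B /(uc_closureP _ ucF)[sA cA] /(uc_closureP _ ucF)[sB cB].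
apply/(uc_closureP _ ucF); split.
  move: sA sB; rewrite !in_nonempty_subsets subUset => /andP[A0 ->] /andP[_ ->].
  by rewrite andbT setU_eq0 (negPf A0).
move=> C CF; rewrite -setUA; have /setU1P[->|BCF] := cB C CF.
  exact: setU11.
have /setU1P[eqA|ABCF] := cA _ BCF; last exact: setU1r.
rewrite eqA; have /setUidPl-> : B \subset A; last exact: setU11.
by rewrite -eqA setUCA subsetUl.
Qed.

Lemma union_closed_iter F i : union_closed U F -> union_closed U (iter_closure U i F).
Proof. by move=> ucF; elim: i => //= i; apply: union_closed_closure. Qed.

Lemma iter_closureSP F i A : union_closed U F ->
  reflect (A \in nonempty_subsets U /\
           {in iter_closure U i F, forall B, A :|: B \in A |: iter_closure U i F})
          (A \in iter_closure U i.+1 F).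
Proof. by move=> ucF; apply: uc_closureP; apply: union_closed_iter. Qed.

(** A union with a set not contained in [A] gains at least one element, which pays for the step from
    [i.+1] back to [i]. *)
Lemma iter_closure_large F i A : union_closed U F ->
  A \in nonempty_subsets U -> #|U| <= #|A| + i -> A \in iter_closure U i F.
Proof.
move=> ucF; elim: i A => [|i IH] A sA leUA.
  have /union_closedP[_ UF _] := ucF.
  move: sA; rewrite in_nonempty_subsets => /andP[_ AU].
  suff /eqP-> : A == U by [].
  by rewrite eqEcard AU -[#|A|]addn0.
apply/(iter_closureSP _ _ ucF); split=> // B BF.
have [BA|nBA] := boolP (B \subset A); first by rewrite (setUidPl BA) setU11.
have /union_closedP[sF _ _] := union_closed_iter i ucF.
move: sA (sF B BF); rewrite !in_nonempty_subsets => /andP[A0 AU] /andP[_ BU].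
rewrite setU1r // IH ?in_nonempty_subsets ?setU_eq0 ?(negPf A0) ?subUset ?AU //.
have /proper_card : A \proper A :|: B by rewrite properUl.
lia.
Qed.

End Closure.

(** Supplies the low set whose union with a mixed set of small trace witnesses that the latter is
    outside the next closure. *)
Lemma exists_intermediate_card (T : finType) (A U : {set T}) m :
  A \subset U -> #|A| <= m <= #|U| ->
  exists B : {set T}, [/\ A \subset B, B \subset U & #|B| = m].
Proof.
move=> AU /andP[leAm lemU].
pose s := take (m - #|A|) (enum (U :\: A)).
have sD x : x \in s -> x \in U :\: A by move/mem_take; rewrite mem_enum.
have cs : #|[set x in s]| = m - #|A|.
  rewrite cardsE (card_uniqP _) ?take_uniq ?enum_uniq // size_takel //.
  by rewrite -cardE cardsD (setIidPr AU) leq_sub2r.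
exists (A :|: [set x in s]); split; first exact: subsetUl.
  rewrite subUset AU; apply/subsetP=> x; rewrite inE => /sD.
  by rewrite inE => /andP[].
rewrite cardsU cs (_ : A :&: _ = set0) ?cards0 ?subn0 ?subnKC //.
apply/setP=> x; rewrite !inE; apply/andP=> -[Ax /sD].
by rewrite inE Ax.
Qed.

(** * Closures after adjoining a larger universe; the trace of [A] is [A :&: K] *)

Section Extension.

Variables (T : finType) (K : {set T}) (F : {set {set T}}).
(** Says that the complement of [K] is nonempty, so that no set is both low and full. *)
Hypothesis properK : ~~ (~: K \subset K).
Hypothesis ucF : union_closed K F.

Local Notation H := (F :|: [set [set: T]]).
Local Notation Fi i := (iter_closure K i F).
Local Notation Hi i := (iter_closure [set: T] i H).

Hypothesis ucH : union_closed [set: T] H.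

Implicit Types A B E X Y : {set T}.

Definition mixed A := ~~ (A \subset K) && ~~ (~: K \subset A).

Lemma full_notlow A : ~: K \subset A -> ~~ (A \subset K).
Proof. by move=> fA; apply: contra properK; apply: subset_trans. Qed.

Lemma full_setU_low A E : E \subset K -> (~: K \subset A :|: E) = (~: K \subset A).
Proof.
move=> EK; apply/idP/idP => [/subsetP fAE|fA].
  apply/subsetP=> x xK; have := fAE x xK.
  by rewrite inE => /orP[//|/(subsetP EK)]; rewrite inE in xK; rewrite (negPf xK).
by rewrite (subset_trans fA) ?subsetUl.
Qed.

Lemma mixed_setU_low A E : E \subset K -> mixed (A :|: E) = mixed A.
Proof. by move=> EK; rewrite /mixed full_setU_low // subUset EK andbT. Qed.

Lemma low_mixed_full A : [\/ A \subset K, mixed A | ~: K \subset A].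
Proof.
rewrite /mixed; case: (boolP (A \subset K)) => lA; first exact: Or31.
by case: (boolP (~: K \subset A)) => fA; [apply: Or33|apply: Or32].
Qed.

Lemma Fi_low i E : E \in Fi i -> E \subset K.
Proof.
have /union_closedP[sF _ _] := union_closed_iter i ucF.
by move/sF; rewrite in_nonempty_subsets => /andP[].
Qed.

Lemma card_trace_setU A B :
  #|A :&: K| <= #|(A :|: B) :&: K| /\ #|B :&: K| <= #|(A :|: B) :&: K|.
Proof. by split; apply/subset_leq_card/setSI; rewrite ?subsetUl ?subsetUr. Qed.

Lemma card_trace_setU_low A E : E \subset K -> ~~ (E \subset A) ->
  #|A :&: K| < #|(A :|: E) :&: K|.
Proof.
move=> EK nEA; apply/proper_card/properP; split; first by apply/setSI/subsetUl.
have /subsetPn[x xE xA] := nEA; exists x; last by rewrite inE (negPf xA).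
by rewrite !inE xE orbT (subsetP EK).
Qed.

(** The bound in [full_large] is one weaker than in [mixed_memE]: it is exactly what a mixed member
    of the next closure guarantees for its union with a full set. *)
Record trace_invariant i : Prop := TraceInvariant {
  low_memE : forall A, A \subset K -> (A \in Hi i) = (A \in Fi i);
  mixed_memE : forall A, mixed A -> (A \in Hi i) = (#|K| < #|A :&: K| + i);
  full_upward : forall X Y, ~: K \subset X -> X \subset Y -> X \in Hi i -> Y \in Hi i;
  full_large : forall A, ~: K \subset A -> #|K| <= #|A :&: K| + i -> A \in Hi i }.

Lemma HiSP i A : A != set0 ->
  reflect {in Hi i, forall B, A :|: B \in A |: Hi i} (A \in Hi i.+1).
Proof.
move=> A0; apply: (iffP (iter_closureSP _ _ ucH)) => [[]|] //.
by split=> //; rewrite in_nonempty_subsets A0 subsetT.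
Qed.

Lemma trace_invariant0 : trace_invariant 0.
Proof.
have low_T A : A \subset K -> (A == [set: T]) = false.
  move=> AK; apply/negP=> /eqP AT.
  by have := full_notlow (subsetT (~: K)); rewrite -AT AK.
split=> /=.
- by move=> A /low_T AT; rewrite !inE AT orbF.
- move=> A mA; rewrite addn0 ltnNge subset_leq_card ?subsetIr //=.
  apply/negP=> /setUP[/(Fi_low (i := 0)) AK|/set1P AT].
    by move: mA; rewrite /mixed AK.
  by move: mA; rewrite /mixed AT !subsetT andbF.
- move=> X Y fX XY /setUP[/(Fi_low (i := 0)) XK|/set1P XT].
    by have := full_notlow fX; rewrite XK.
  suff -> : Y = [set: T] by rewrite !inE eqxx orbT.
  by apply/eqP; rewrite -subTset -XT.
move=> A fA; rewrite addn0 => leK.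
have KA : K \subset A by apply/setIidPr/eqP; rewrite eqEcard subsetIr.
suff -> : A = [set: T] by rewrite !inE eqxx orbT.
by apply/eqP; rewrite -subTset -(setUCr K) subUset KA.
Qed.

(** Unions with the other members of [Hi i] are automatic: a mixed member already has a trace large
    enough for [full_large], and a full member passes to its supersets by [full_upward]. *)
Lemma full_closureSP i A : trace_invariant i -> ~: K \subset A ->
  reflect {in Fi i, forall E, ~~ (E \subset A) -> A :|: E \in Hi i} (A \in Hi i.+1).
Proof.
move=> [lowE mixE fullU fullL] fA.
have A0 : A != set0 by apply: contra (full_notlow fA) => /eqP->; apply: sub0set.
apply: (iffP (HiSP _ A0)) => [cA E EF nEA|cA B BH].
  have EH : E \in Hi i by rewrite lowE ?(Fi_low EF).
  have /setU1P[AE|//] := cA E EH.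
  by rewrite -AE subsetUr in nEA.
have [lB|mB|fB] := low_mixed_full B.
- have [BA|nBA] := boolP (B \subset A); first by rewrite (setUidPl BA) setU11.
  by rewrite setU1r // cA // -lowE.
- rewrite setU1r // fullL ?(subset_trans fA) ?subsetUl //.
  have := card_trace_setU A B; move: BH; rewrite mixE //; lia.
- by rewrite setU1r // (fullU B) ?subsetUr.
Qed.

Lemma trace_invariantS i : i < #|K| -> trace_invariant i -> trace_invariant i.+1.
Proof.
move=> ltiK inv; have [lowE mixE fullU fullL] := inv; split.
(* Low sets: unions with mixed or full members of [Hi i] stay in [Hi i], so only the low members,
   that is [Fi i], impose a condition. *)
- move=> A AK; have [->|A0] := eqVneq A set0.
    apply/idP/idP => [/(iter_closureSP _ _ ucH)|/(iter_closureSP _ _ ucF)] [];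
      by rewrite in_nonempty_subsets eqxx.
  apply/(HiSP _ A0)/(iter_closureSP _ _ ucF) => [cA|[_ cA] B BH].
    rewrite in_nonempty_subsets A0 AK; split=> // B BF.
    have BK := Fi_low BF.
    have := cA B; rewrite (lowE B) // => /(_ BF).
    by rewrite !in_setU1 lowE // subUset AK.
  have [lB|mB|fB] := low_mixed_full B.
  + have := cA B; rewrite -lowE // => /(_ BH).
    by rewrite !in_setU1 lowE // subUset AK.
  + rewrite setU1r // mixE; last by rewrite setUC mixed_setU_low.
    have := card_trace_setU A B; move: BH; rewrite mixE //; lia.
  + by rewrite setU1r // (fullU B) ?subsetUr.
- move=> A mA; have /andP[nlA nfA] := mA.
  have A0 : A != set0 by apply: contra nlA => /eqP->; apply: sub0set.
  apply/(HiSP _ A0)/idP => [cA|leKA B BH].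
    (* A union with a member of F_i of size |K| - i containing the trace of A
       is mixed, but its trace is too small for H_i. *)
    rewrite ltnNge; apply/negP=> leAK.
    have [|B [AB BK cB]] := @exists_intermediate_card _ (A :&: K) K (#|K| - i) (subsetIr _ _).
      by lia.
    have BF : B \in Fi i.
      apply: iter_closure_large => //; last by lia.
      (* Here [i < #|K|] makes [B] nonempty. *)
      by rewrite in_nonempty_subsets BK andbT -card_gt0 cB subn_gt0.
    have trU : (A :|: B) :&: K = B.
      by rewrite setIUl (setIidPl BK); apply/setUidPr.
    (* The union cannot be [A] itself, whose trace has fewer than [#|K| - i] elements. *)
    have := cA B; rewrite (lowE B) // => /(_ BF) /setU1P[AE|].
      by move: trU; rewrite AE => trA; move: leAK; rewrite trA; lia.
    rewrite mixE ?mixed_setU_low // trU; lia.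
  (* A low [B] outside [A] adds a point to the trace; a mixed [B] brings a large enough trace
     itself, whether the union is mixed or full; for a full [B] the trace of [A] suffices. *)
  have [lB|mB|fB] := low_mixed_full B.
  + have [BA|nBA] := boolP (B \subset A); first by rewrite (setUidPl BA) setU11.
    rewrite setU1r // mixE ?mixed_setU_low //.
    have := card_trace_setU_low lB nBA; lia.
  + have [leA leB] := card_trace_setU A B; move: BH; rewrite mixE // => ltB.
    rewrite setU1r //; have [fU|nfU] := boolP (~: K \subset A :|: B).
      by rewrite fullL //; lia.
    by rewrite mixE ?/mixed ?nfU ?subUset ?(negPf nlA) //; lia.
  + have [leA _] := card_trace_setU A B.
    by rewrite setU1r // fullL ?(subset_trans fB) ?subsetUr //; lia.
- move=> X Y fX XY /(full_closureSP inv fX) cX.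
  apply/(full_closureSP inv (subset_trans fX XY)) => E EF nEY.
  apply: (fullU (X :|: E)); [|exact: setSU|].
    by rewrite (subset_trans fX) ?subsetUl.
  by rewrite cX //; apply: contra nEY => /subset_trans->.
- move=> A fA leKA; apply/(full_closureSP inv fA) => E EF nEA.
  apply: fullL; first by rewrite (subset_trans fA) ?subsetUl.
  have := card_trace_setU_low (Fi_low EF) nEA; lia.
Qed.

Lemma trace_invariant_le i : i <= #|K| -> trace_invariant i.
Proof.
elim: i => [_|i IH ltiK]; first exact: trace_invariant0.
exact: trace_invariantS (IH (ltnW ltiK)).
Qed.

End Extension.

(** * Specialisation to initial segments *)

Lemma card_segment n k : k <= n -> #|segment n k| = k.
Proof.
move=> lekn; have widen_inj : injective (widen_ord lekn).
  by move=> i j /(congr1 val) /= /val_inj.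
rewrite -[RHS]card_ord -(card_imset _ widen_inj).
apply: eq_card => i; rewrite inE; apply/idP/imsetP => [ltik|[j _ ->]].
  by exists (Ordinal ltik) => //; apply: val_inj.
exact: (ltn_ord j).
Qed.

Theorem theorem2 (k n : nat) (hk : 0 < k) (hn : k + 2 <= n)
    (F : {set {set 'I_n}}) (hF : union_closed (segment n k) F)
    (A : {set 'I_n}) (hA : A \in nonempty_subsets [set: 'I_n])
    (t : nat) (ht : 1 <= t <= k) :
  let K := segment n k in
  let N := [set: 'I_n] in
  let H := F :|: [set N] in
  let A1 := A :&: K in
  let A2 := A :&: (N :\: K) in
  ((A2 = set0 /\ A1 \in iter_closure K t F) \/
   (A2 = N :\: K /\
      forall E : {set 'I_n}, E \in iter_closure K (t - 1) F ->
        ~ (E \subset A) -> E :|: A \in iter_closure N (t - 1) H) \/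
   (k - t + 1 <= #|A1|)
   -> A \in iter_closure N t H)
  /\
  ((A2 = set0 /\ A1 \notin iter_closure K t F) \/
   (A2 = N :\: K /\
      exists E : {set 'I_n}, [/\ E \in iter_closure K (t - 1) F,
        ~ (E \subset A) & E :|: A \notin iter_closure N (t - 1) H]) \/
   [/\ A2 <> set0, A2 <> N :\: K & #|A1| <= k - t]
   -> A \notin iter_closure N t H).
Proof.
move=> K N H A1 A2.
have cK : #|K| = k by apply: card_segment; lia.
have properK : ~~ (~: K \subset K).
  have ltkn : k < n by lia.
  (* Numbering starts at 0, so the ordinal [k] is the first element outside [K]. *)
  by apply/subsetPn; exists (Ordinal ltkn); rewrite !inE /= ltnn.
have ucH : union_closed N H by apply: union_closed_extend hF; lia.
have inv i : i <= k -> trace_invariant K F i.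
  by move=> leik; apply: trace_invariant_le; rewrite ?cK.
have [lowE mixE _ fullL] := inv t (proj2 (andP ht)).
have lowP : A2 = set0 <-> A \subset K.
  rewrite /A2 setTD -setDE; split=> [/eqP|AK]; first by rewrite setD_eq0.
  by apply/eqP; rewrite setD_eq0.
have fullP : A2 = N :\: K <-> ~: K \subset A by rewrite /A2 setTD; split=> /setIidPr.
have fullSP : ~: K \subset A ->
    reflect {in iter_closure K (t - 1) F,
      forall E : {set 'I_n}, ~~ (E \subset A) -> A :|: E \in iter_closure N (t - 1) H}
    (A \in iter_closure N t H).
  move=> fA; have -> : t = (t - 1).+1 by lia.
  rewrite subn1 /=; apply: full_closureSP => //; apply: inv; lia.
split.
- case=> [[/lowP AK]|[[/fullP fA cA]|leA1]].
  + by rewrite /A1 (setIidPl AK) lowE.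
  + by apply/(fullSP fA) => E EF /negP nEA; rewrite setUC; apply: cA.
  (* Condition (v) leaves [A2] free, so all three types occur. A low [A] equals its trace and is
     large inside [K]. *)
  + have [lA|mA|fA] := low_mixed_full K A.
    * rewrite lowE //; apply: iter_closure_large => //.
        by move: hA; rewrite !in_nonempty_subsets lA => /andP[->].
      by move: leA1; rewrite /A1 (setIidPl lA) cK; lia.
    * by rewrite mixE // cK -/A1; lia.
    * by apply: fullL => //; rewrite cK -/A1; lia.
case=> [[/lowP AK]|[[/fullP fA [E [EF /negP nEA nH]]]|[nl nf leA1]]].
- by rewrite /A1 (setIidPl AK) lowE.
- by apply: contra nH => /(fullSP fA) cA; rewrite setUC cA.
(* Condition (vi) says that [A] is mixed with a trace below the exact threshold of [mixE]. *)
have mA : mixed K A.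
  by apply/andP; split; apply/negP; [move/lowP | move/fullP].
by rewrite mixE // cK -/A1; lia.
Qed.
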